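(* Let $R$ be an oriented ring with $n$ nodes in which each node has a whiteboard, and let two synchronous agents start at safe nodes of $R$. Let $C$ be the set of nodes that are possible positions of the Byzantine black hole $v_b$ (that is, all the agents know about $v_b$ is that $v_b\in C$). If $C$ contains at least $3$ consecutive nodes of $R$, then the two agents cannot solve PerpExploration-BBH on $R$: for every deterministic algorithm there exist a position $v_b\in C$ and a behaviour of the adversary under which it is not the case that every node of $R$ other than $v_b$ is visited infinitely often.
   Context: Model. $R=\{v_0,\dots,v_{n-1}\}$ is a ring with unlabeled nodes; node $v_i$ has two ports, leading to $v_{(i-1)\bmod n}$ and $v_{(i+1)\bmod n}$, consistently labeled left and right. Agents know $n$, have distinct IDs (from $[0,k^c]$, where $k$ is the number of agents and $c$ a constant), have $O(\log n)$ bits of internal memory, and all run the same deterministic algorithm. Time proceeds in synchronous rounds; in each round every agent at a node $v$ takes a snapshot (the two ports, the content of the whiteboard of $v$, its own memory, the IDs of the agents currently at $v$), then performs a communication step (reading/writing the whiteboard of $v$) and a move step (stay, or move through a port, being at the corresponding neighbour in the next round). Agents crossing the same edge in opposite directions do not notice each other. A whiteboard is a memory of $O(\log n)$ bits at each node, which agents at that node can read and modify in mutual exclusion; whiteboards are initially blank. Byzantine black hole. Exactly one node $v_b$ is a Byzantine black hole; all other nodes are safe; its position is fixed and unknown to the agents, and it is not a starting node of any agent. At the beginning of each round an adversary (who knows the algorithm) decides whether $v_b$ is active during that round. If active, all agents at $v_b$ in that round are destroyed without trace, and the adversary may additionally choose to erase the information stored at $v_b$. If not active, $v_b$ behaves exactly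 like a safe node. PerpExploration-BBH: the agents must move so that every node of $R$ except $v_b$ is visited by at least one agent infinitely often. An algorithm solves the problem if this holds for every possible position of $v_b$ and every behaviour of the adversary. *)

(* Defs.v *)
From mathcomp Require Import all_boot all_fingroup.

Set Implicit Arguments.
Unset Strict Implicit.
Unset Printing Implicit Defensive.

(* Perpetual exploration of an oriented ring with a Byzantine black hole, over
   MathComp.  The parameters of the model are
     n    the number of nodes,
     k    the number of agents,
     c    the exponent in the range [0, k ^ c] of the agent IDs,
     a b  the constants hidden in the O(log n) bounds: agents have
          a * ceil(log2 n) bits of memory, whiteboards b * ceil(log2 n) bits. *)

Definition agent_id (k c : nat) := 'I_(k ^ c).+1.
Definition memory (a n : nat) := (a * up_log 2 n).-tuple bool.
Definition whiteboard (b n : nat) := (b * up_log 2 n).-tuple bool.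
Definition blank (b n : nat) : whiteboard b n := nseq_tuple _ false.

Inductive move := Stay | GoLeft | GoRight.

Definition target (n : nat) (d : move) (v : 'I_n) : 'I_n :=
  match d with
  | Stay => v
  | GoLeft => ord_pred v
  | GoRight => ordS v
  end.

(* Nodes are unlabeled, and all have the same two labeled ports, so neither the
   name of the node nor its ports appear among the data of a snapshot. *)
Record snapshot (n k c a b : nat) := Snapshot {
  own_id  : agent_id k c;
  own_mem : memory a n;
  board   : whiteboard b n;
  present : {set agent_id k c}
}.

(* [act P s w] is what an agent does in a round in which its snapshot is [s] and
   the whiteboard contains [w] when the agent obtains access to it; [w] differs
   from [board s] if other agents at the node have already written in that round.
   The result is the new memory, the new content of the whiteboard, the move. *)
Record algorithm (n k c a b : nat) := Algorithm {
  init_mem : agent_id k c -> memory a n;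
  act : snapshot n k c a b -> whiteboard b n ->
        memory a n * whiteboard b n * move
}.

(* [loc s i = None] means that agent [i] has been destroyed. *)
Record config (n k a b : nat) := Config {
  loc : {ffun 'I_k -> option 'I_n};
  amem : {ffun 'I_k -> memory a n};
  wb  : {ffun 'I_n -> whiteboard b n}
}.

(* The adversary's choice in a round; [Active true] also erases the whiteboard
   of the black hole. *)
Inductive activity := Inactive | Active of bool.

Definition strike (n k a b : nat) (vb : 'I_n) (x : activity)
    (s : config n k a b) : config n k a b :=
  match x with
  | Inactive => s
  | Active erase =>
      Config [ffun i => if loc s i == Some vb then None else loc s i]
             (amem s)
             [ffun v => if erase && (v == vb) then blank b n else wb s v]
  end.

Definition ids_at (n k c a b : nat) (ident : 'I_k -> agent_id k c)
    (s : config n k a b) (v : 'I_n) : {set agent_id k c} :=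
  [set ident i | i : 'I_k & loc s i == Some v].

(* Agent [i] performs its communication and move steps.  Snapshots and departure
   nodes are read in [s], the configuration in which the snapshots are taken;
   [s'] is the configuration resulting from the agents already processed. *)
Definition agent_step (n k c a b : nat) (ident : 'I_k -> agent_id k c)
    (P : algorithm n k c a b) (s s' : config n k a b) (i : 'I_k) :
    config n k a b :=
  if loc s i is Some v then
    let: (m, w, d) :=
      act P (Snapshot (ident i) (amem s i) (wb s v) (ids_at ident s v)) (wb s' v) in
    Config [ffun j => if j == i then Some (target d v) else loc s' j]
           [ffun j => if j == i then m else amem s' j]
           [ffun u => if u == v then w else wb s' u]
  else s'.

(* Mutual exclusion: [mutex t s] gives the order in which the agents access the
   whiteboards in round [t], [s] being the configuration in which the snapshots
   are taken.  Only the order among agents at the same node matters. *)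
Definition mutex_rule (n k a b : nat) := nat -> config n k a b -> 'S_k.

Definition round (n k c a b : nat) (ident : 'I_k -> agent_id k c)
    (P : algorithm n k c a b) (mutex : mutex_rule n k a b) (t : nat)
    (s : config n k a b) : config n k a b :=
  foldl (agent_step ident P s) s [seq mutex t s j | j <- enum 'I_k].

Definition init_config (n k c a b : nat) (ident : 'I_k -> agent_id k c)
    (start : 'I_k -> 'I_n) (P : algorithm n k c a b) : config n k a b :=
  Config [ffun i => Some (start i)]
         [ffun i => init_mem P (ident i)]
         [ffun=> blank b n].

(* [run ident start P mutex vb adv t] is the configuration at the beginning of round
   [t], before the black hole at [vb] acts as prescribed by [adv t].  Since the
   system is deterministic, the behaviour of an adversary reacting to the past is
   also described by its sequence of choices [adv]. *)
Fixpoint run (n k c a b : nat) (ident : 'I_k -> agent_id k c)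
    (start : 'I_k -> 'I_n) (P : algorithm n k c a b)
    (mutex : mutex_rule n k a b) (vb : 'I_n) (adv : nat -> activity) (t : nat) :
    config n k a b :=
  if t is t'.+1 then
    round ident P mutex t' (strike vb (adv t') (run ident start P mutex vb adv t'))
  else init_config ident start P.

Definition visited_at (n k a b : nat) (s : config n k a b) (v : 'I_n) : Prop :=
  exists i : 'I_k, loc s i = Some v.

Definition perp_exploration (n k c a b : nat) (ident : 'I_k -> agent_id k c)
    (start : 'I_k -> 'I_n) (P : algorithm n k c a b)
    (mutex : mutex_rule n k a b) (vb : 'I_n) (adv : nat -> activity) : Prop :=
  forall v : 'I_n, v != vb ->
  forall T : nat, exists2 t : nat,
    T <= t & visited_at (run ident start P mutex vb adv t) v.

(* Main.v *)
(** Let [x], [y] be distinct nodes of [C] and suppose that, in the execution in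
    which the black hole is never active, an agent [A] is at [x] in some round
    and at [y] in the next one.  The adversary can destroy [A] at [x] (if
    [vb = x]) or one round later at [y] (if [vb = y]).  The other agent cannot
    tell these two cases apart before it enters [x] or [y].  If it enters [x]
    first, it is destroyed in the first case; if it enters [y] first, it is
    destroyed in the second case; and if it enters neither, [y] is not visited
    any more in the first case.  So in this execution no agent moves from a node
    of [C] to another one; but the middle one of three consecutive nodes of [C]
    can only be reached in this way. *)
Require Import Defs.
From mathcomp Require Import all_boot all_fingroup.
From Stdlib Require Import Classical.

Set Implicit Arguments.
Unset Strict Implicit.
Unset Printing Implicit Defensive.

(** * Effect of one round, and of one strike, on each agent and each whiteboard *)

Section Rounds.

Variables (n k c a b : nat) (ident : 'I_k -> agent_id k c).
Variable P : algorithm n k c a b.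
Implicit Types (s : config n k a b) (i j : 'I_k) (u v : 'I_n).

Lemma agent_step_other s s' i j : j != i ->
  loc (agent_step ident P s s' j) i = loc s' i /\
  amem (agent_step ident P s s' j) i = amem s' i.
Proof.
rewrite /agent_step eq_sym => /negPf ji; case: (loc s j) => // v.
by case: (Defs.act _ _ _) => -[m w] d; rewrite !ffunE ji.
Qed.

Lemma agent_step_wb s s' j u : loc s j != Some u ->
  wb (agent_step ident P s s' j) u = wb s' u.
Proof.
rewrite /agent_step; case: (loc s j) => // v vu.
case: (Defs.act _ _ _) => -[m w] d; rewrite ffunE.
by case: eqP => // uv; rewrite uv eqxx in vu.
Qed.

Lemma foldl_agent_step_other s s' i (l : seq 'I_k) : i \notin l ->
  loc (foldl (agent_step ident P s) s' l) i = loc s' i /\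
  amem (foldl (agent_step ident P s) s' l) i = amem s' i.
Proof.
elim: l s' => //= j l IH s'; rewrite inE negb_or eq_sym => /andP[ji il].
by case: (IH (agent_step ident P s s' j) il) => -> ->; apply: agent_step_other.
Qed.

Lemma foldl_agent_step_wb s s' u (l : seq 'I_k) :
  {in l, forall j, loc s j != Some u} ->
  wb (foldl (agent_step ident P s) s' l) u = wb s' u.
Proof.
elim: l s' => //= j l IH s' Hl.
rewrite IH; last by move=> i il; apply: Hl; rewrite inE il orbT.
by apply: agent_step_wb; apply: Hl; rewrite inE eqxx.
Qed.

Variable mutex : mutex_rule n k a b.

(** The access order is a permutation, so each agent acts exactly once per round. This isolates its
    step from those before and after it. *)
Lemma mutex_split t s i : exists l1 l2,
  [/\ [seq mutex t s j | j <- enum 'I_k] = l1 ++ i :: l2,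
      i \notin l1 & i \notin l2].
Proof.
set l := [seq _ | _ <- _].
have il : i \in l.
  by apply/mapP; exists ((mutex t s)^-1%g i); rewrite ?mem_enum ?permKV.
have : uniq l by rewrite map_inj_uniq ?enum_uniq //; apply: perm_inj.
case/splitPr: il => l1 l2; rewrite cat_uniq /= negb_or => /and3P[_ /andP[i1 _]].
by case/andP=> i2 _; exists l1, l2.
Qed.

Lemma round_dead t s i : loc s i = None ->
  loc (round ident P mutex t s) i = None.
Proof.
move=> si; rewrite /round; have [l1 [l2 [-> i1 i2]]] := mutex_split t s i.
rewrite foldl_cat /= (proj1 (foldl_agent_step_other _ _ i2)).
by rewrite {1}/agent_step si (proj1 (foldl_agent_step_other _ _ i1)).
Qed.

Lemma round_alive t s i v : loc s i = Some v ->
  exists d, loc (round ident P mutex t s) i = Some (target d v).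
Proof.
move=> si; rewrite /round; have [l1 [l2 [-> i1 i2]]] := mutex_split t s i.
rewrite foldl_cat /= (proj1 (foldl_agent_step_other _ _ i2)).
rewrite {1}/agent_step si; case: (Defs.act _ _ _) => -[m w] d.
by exists d; rewrite ffunE eqxx.
Qed.

Lemma round_wb t s u : (forall j, loc s j != Some u) ->
  wb (round ident P mutex t s) u = wb s u.
Proof. by move=> H; apply: foldl_agent_step_wb => j _; apply: H. Qed.

(** Nobody else writes at [v], so the access order and the rest of the ring have no influence on
    what [i] does. *)
Lemma round_alone t s i v : loc s i = Some v ->
  (forall j, j != i -> loc s j != Some v) ->
  let: (m, w, d) :=
    Defs.act P (Snapshot (ident i) (amem s i) (wb s v) [set ident i]) (wb s v) in
  [/\ loc (round ident P mutex t s) i = Some (target d v),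
      amem (round ident P mutex t s) i = m &
      wb (round ident P mutex t s) v = w].
Proof.
move=> si alone.
have ids : ids_at ident s v = [set ident i].
  rewrite /ids_at (_ : [set j | _] = [set i]) ?imset_set1 //.
  apply/setP => j; rewrite !inE; case: (eqVneq j i) => [->|/alone/negPf //].
  by rewrite si eqxx.
have off (l : seq _) : i \notin l -> {in l, forall j, loc s j != Some v}.
  by move=> il j jl; apply: alone; apply: contraNneq il => <-.
rewrite /round; have [l1 [l2 [-> i1 i2]]] := mutex_split t s i.
rewrite foldl_cat /=; case: (foldl_agent_step_other s
  (agent_step ident P s (foldl (agent_step ident P s) s l1) i) i2) => -> ->.
rewrite (foldl_agent_step_wb _ (@off l2 i2)) {1 3 5}/agent_step si ids.
rewrite (foldl_agent_step_wb _ (@off l1 i1)).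
by case: (Defs.act _ _ _) => -[m w] d; rewrite !ffunE !eqxx.
Qed.

Lemma strike_dead vb x s i : loc s i = None -> loc (strike vb x s) i = None.
Proof. by case: x => //= e si; rewrite ffunE si. Qed.

Lemma strike_killed vb e s i :
  loc s i = Some vb -> loc (strike vb (Active e) s) i = None.
Proof. by move=> si; rewrite ffunE si eqxx. Qed.

Lemma strike_spared vb x s i :
  loc s i != Some vb -> loc (strike vb x s) i = loc s i.
Proof. by case: x => //= e /negPf si; rewrite ffunE si. Qed.

Lemma strike_amem vb x s : amem (strike vb x s) = amem s.
Proof. by case: x. Qed.

Lemma strike_wb vb s : wb (strike vb (Active false) s) = wb s.
Proof. by apply/ffunP => v; rewrite ffunE. Qed.

Variable start : 'I_k -> 'I_n.

(** The position of the black hole enters a run only through strikes, hence stays invisible until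
    the first one. *)
Lemma eq_run vb vb' adv adv' t :
  (forall t', t' < t -> adv t' = Inactive /\ adv' t' = Inactive) ->
  run ident start P mutex vb adv t = run ident start P mutex vb' adv' t.
Proof.
elim: t => //= t IH H; have [-> ->] := H t (ltnSn t).
by rewrite IH // => t' lt_t'; apply: H; rewrite ltnS ltnW.
Qed.

Lemma all_dead vb adv t v :
  (forall i, loc (strike vb (adv t) (run ident start P mutex vb adv t)) i = None) ->
  v != vb -> ~ perp_exploration ident start P mutex vb adv.
Proof.
move=> dead vvb /(_ v vvb t.+1) [t' lt_t [i]].
suff -> : loc (run ident start P mutex vb adv t') i = None by [].
rewrite -(subnKC lt_t); elim: (_ - _) => [|d IH].
  by rewrite addn0; apply: round_dead.
by rewrite addnS; apply: round_dead; apply: strike_dead.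
Qed.

End Rounds.

(** * Two runs that the surviving agent [B] cannot tell apart *)

Section Twins.

Variables (n c a b : nat) (ident : 'I_2 -> agent_id 2 c).
Variables (P : algorithm n 2 c a b) (mutex : mutex_rule n 2 a b).
Variables (A B : 'I_2) (x y : 'I_n).
Hypotheses (AB : A != B) (xy : x != y).
Implicit Types s : config n 2 a b.

Let agentP (i : 'I_2) : i = A \/ i = B.
Proof.
by apply/pred2P; move: AB; case: A B i => [[|[|?]] ?] [[|[|?]] ?] [[|[|?]] ?].
Qed.

(* [s1] and [s2] look the same to [B] as long as it does not enter [x]. *)
Definition twins s1 s2 :=
  [/\ exists v, loc s1 B = Some v /\ loc s2 B = Some v,
      amem s1 B = amem s2 B &
      forall u, u != x -> wb s1 u = wb s2 u].

(** Off [x], agent [B] is alone at its node in both configurations, so it acts identically. If [A]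
    still acts in [s2], it writes only at [x], whose whiteboard [twins] ignores. *)
Lemma twins_round t s1 s2 : twins s1 s2 ->
  loc s1 A = None -> loc s2 A = None \/ loc s2 A = Some x ->
  loc s1 B != Some x ->
  twins (round ident P mutex t s1) (round ident P mutex t s2).
Proof.
move=> [[v [s1B s2B]] eqm eqw] s1A s2A; rewrite s1B => vx.
have A2 u : u != x -> loc s2 A != Some u.
  by case: s2A => -> // ux; rewrite eq_sym in ux; apply: contraNneq ux => -[->].
have {}vx : v != x by apply: contraNneq vx => ->.
have alone1 j : j != B -> loc s1 j != Some v.
  by case: (agentP j) => ->; rewrite ?eqxx // s1A.
have alone2 j : j != B -> loc s2 j != Some v.
  by case: (agentP j) => ->; rewrite ?eqxx // => _; apply: A2.
have := round_alone ident P mutex t s1B alone1.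
have := round_alone ident P mutex t s2B alone2.
rewrite eqm (eqw _ vx); case: (Defs.act _ _ _) => -[m w] d [l2 m2 w2] [l1 m1 w1].
split; [by exists (target d v) | by rewrite m1 m2 | move=> u ux].
case: (eqVneq u v) => [-> | uv]; first by rewrite w1 w2.
have vu : Some v != Some u by apply: contraNneq uv => -[->].
rewrite !round_wb ?eqw // => j; case: (agentP j) => ->; rewrite ?s1A ?s1B ?s2B //.
exact: A2.
Qed.

Lemma no_move_between_suspects (start : 'I_2 -> 'I_n) (vb : 'I_n) t :
  (forall adv, perp_exploration ident start P mutex x adv) ->
  (forall adv, perp_exploration ident start P mutex y adv) ->
  (forall i, loc (run ident start P mutex vb (fun=> Inactive) t) i != None) ->
  loc (run ident start P mutex vb (fun=> Inactive) t) A = Some x ->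
  loc (run ident start P mutex vb (fun=> Inactive) t.+1) A <> Some y.
Proof.
move=> Hx Hy alive At At1.
(* Dormant before round [t0], active ever after. Nothing is erased, so a strike never makes the
   whiteboards of the two runs differ. *)
pose adv t0 t' := if t' < t0 then Inactive else Active false.
have advlt t0 t' : t' < t0 -> adv t0 t' = Inactive by rewrite /adv => ->.
have advge t0 t' : t0 <= t' -> adv t0 t' = Active false.
  by rewrite /adv leqNgt => /negPf->.
pose r1 := run ident start P mutex x (adv t).
pose r2 := run ident start P mutex y (adv t.+1).
have r1t : r1 t = run ident start P mutex vb (fun=> Inactive) t.
  by apply: eq_run => t' lt_t'; rewrite advlt.
have r2t t' : t' <= t.+1 -> r2 t' = run ident start P mutex vb (fun=> Inactive) t'.
  by move=> le_t'; apply: eq_run => u lt_u; rewrite advlt // (leq_trans lt_u).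
have r1S t' : t <= t' ->
    r1 t'.+1 = round ident P mutex t' (strike x (Active false) (r1 t')).
  by move=> le_t; rewrite -(advge _ _ le_t).
have r2S t' : t < t' ->
    r2 t'.+1 = round ident P mutex t' (strike y (Active false) (r2 t')).
  by move=> lt_t; rewrite -(advge _ _ lt_t).
(* With [A] gone, [B] at the active black hole would leave no agent at all, contradicting
   exploration. *)
have B1 t' : t <= t' -> loc (strike x (Active false) (r1 t')) A = None ->
    loc (r1 t') B != Some x.
  move=> le_t r1A; apply/eqP => r1B.
  apply: (@all_dead _ _ _ _ _ ident P mutex start x (adv t) t' y _ _ (Hx _));
    last by rewrite eq_sym.
  by rewrite advge // => i; case: (agentP i) => -> //; apply: strike_killed.
have B2 t' : t < t' -> loc (strike y (Active false) (r2 t')) A = None ->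
    loc (r2 t') B != Some y.
  move=> lt_t r2A; apply/eqP => r2B.
  apply: (@all_dead _ _ _ _ _ ident P mutex start y (adv t.+1) t' x _ xy (Hy _)).
  by rewrite advge // => i; case: (agentP i) => -> //; apply: strike_killed.
(* The alternative [Some y] covers [d = 0]: in the second run [A] has just reached [y] and is
   destroyed by the next strike. *)
have inv d : [/\ loc (r1 (t.+1 + d)) A = None,
    loc (r2 (t.+1 + d)) A = None \/ loc (r2 (t.+1 + d)) A = Some y &
    twins (r1 (t.+1 + d)) (r2 (t.+1 + d))].
  elim: d => [|d [IH1 IH2 IHt]].
    have r1A : loc (strike x (Active false) (r1 t)) A = None.
      by apply: strike_killed; rewrite r1t.
    have r1B := B1 t (leqnn t) r1A.
    rewrite addn0; split.
    - by rewrite r1S // round_dead.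
    - by right; rewrite r2t.
    rewrite r1S // (_ : r2 t.+1 = round ident P mutex t (r2 t)); last first.
      by rewrite {1}/r2 /= advlt.
    (* Round [t] is the only one in which [A] acts in one run alone: it is already destroyed in the
       first, but still moves from [x] in the second. *)
    apply: twins_round => //; last 2 first.
    - by right; rewrite r2t.
    - by rewrite strike_spared.
    rewrite r2t // -r1t; split; last by move=> u _; rewrite strike_wb.
      have := alive B; rewrite -r1t strike_spared //.
      by case: (loc (r1 t) B) => // v _; exists v.
    by rewrite strike_amem.
  set t' := t.+1 + d in IH1 IH2 IHt *.
  have lt_t : t < t' by rewrite leq_addr.
  have r1A : loc (strike x (Active false) (r1 t')) A = None by apply: strike_dead.
  have r2A : loc (strike y (Active false) (r2 t')) A = None.
    by case: IH2 => [/strike_dead-> | /strike_killed->].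
  (* [B] avoids [x] in the first run and [y] in the second, so it survives both strikes. *)
  have r1B := B1 t' (ltnW lt_t) r1A; have r2B := B2 t' lt_t r2A.
  rewrite addnS -/t' (r1S t' (ltnW lt_t)) (r2S t' lt_t).
  split; [exact: round_dead | by left; apply: round_dead |].
  apply: twins_round => //; [|by left | by rewrite strike_spared].
  case: IHt => eql eqm eqw.
  by split; rewrite ?strike_spared ?strike_amem ?strike_wb.
(* In the first run only [B] can make this visit; its twin is then at [y] in the second run, which
   [B2] forbids. *)
have [t' lt_t [i]] : exists2 t', t < t' & visited_at (r1 t') y.
  by apply: Hx; rewrite eq_sym.
have [d def_t'] : exists d, t' = t.+1 + d by exists (t' - t.+1); rewrite subnKC.
move: lt_t; rewrite def_t' => lt_t; have [r1A r2A [[v [r1B r2B]] _ _]] := inv d.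
case: (agentP i) => ->; first by rewrite r1A.
rewrite r1B -r2B; apply/eqP; apply: B2 => //.
by case: r2A => [/strike_dead-> | /strike_killed->].
Qed.

End Twins.

Theorem theorem2 (n : nat) (hn : 2 < n) (C : {set 'I_n})
  (hC : exists v : 'I_n, [/\ v \in C, ordS v \in C & ordS (ordS v) \in C])
  (start : 'I_2 -> 'I_n) (hstart : forall i : 'I_2, start i \notin C)
  (c : nat) (ident : 'I_2 -> agent_id 2 c) (hident : injective ident)
  (a b : nat) (P : algorithm n 2 c a b) (mutex : mutex_rule n 2 a b) :
  exists2 vb : 'I_n, vb \in C &
    exists adv : nat -> activity,
      ~ perp_exploration ident start P mutex vb adv.
Proof.
apply: NNPP => contra.
have H vb : vb \in C -> forall adv, perp_exploration ident start P mutex vb adv.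
  by move=> Cvb adv; apply: NNPP => nH; apply: contra; exists vb => //; exists adv.
case: hC => v [Cv0 Cv1 Cv2].
pose r := run ident start P mutex v (fun=> Inactive).
have alive t i : loc (r t) i != None.
  elim: t => [|t IH]; first by rewrite ffunE.
  case Dv: (loc (r t) i) IH => [u|] // _.
  by have [d] := round_alive ident P mutex t Dv; rewrite /r /= => ->.
(* Agents start outside [C], and both neighbours of the middle node lie in [C], so a first entry
   would be a move between two suspects. *)
have unvisited t i : loc (r t) i <> Some (ordS v).
  elim: t i => [|t IH] i.
    by rewrite ffunE => -[Ev]; have := hstart i; rewrite Ev Cv1.
  case Du: (loc (r t) i) (alive t i) => [u|] // _ rt1.
  have uv : u != ordS v by apply/eqP => Eu; apply: (IH i); rewrite Du Eu.
  have Cu : u \in C.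
    have [d rd] := round_alive ident P mutex t Du.
    move: rt1; rewrite /r /= -/(r t) rd => -[].
    case: d {rd} => /= Eu; first by rewrite Eu eqxx in uv.
    - by rewrite -[u]ord_predK Eu.
    - by rewrite -[u]ordSK Eu ordSK.
  (* In ['I_2], [rev_ord i] is the other agent. *)
  have iB : i != rev_ord i by case: (i) => [[|[|]]].
  exact: (no_move_between_suspects iB uv (H u Cu) (H _ Cv1) (alive t) Du rt1).
have [t _ [i /unvisited]] : exists2 t, 0 <= t & visited_at (r t) (ordS v).
  (* It remains to see that [ordS v] differs from [v]: equality would force [n = 1]. *)
  apply: (H v Cv0); apply/eqP => /(congr1 val) /= Ev; have := ltn_ord v.
  case: (ltnP v.+1 n) Ev => [lt_v | ge_v] Ev lt_n.
    by move: Ev; rewrite modn_small // => /esym/n_Sn.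
  have En : v.+1 = n by apply/eqP; rewrite eqn_leq ge_v lt_n.
  by move: hn; rewrite En modnn in Ev; rewrite -En -Ev.
by [].
Qed.
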